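(* Let $d\ge 1$ and let $f$ be a probability density on $\mathbb{R}^d$ with compact support and a unique global mode $x_0$ (i.e. $\{x_0\}=\arg\max_{x} f(x)$), such that for some constants $0<c_0<C_0$, $h_0>0$ and $\beta>0$: $$f(x_0)-C_0\|x-x_0\|^\beta \le f(x)\le f(x_0)-c_0\|x-x_0\|^\beta \quad\text{whenever } \|x-x_0\|\le h_0,$$ $$f(x)\le f(x_0)-c_0h_0^\beta \quad\text{whenever } \|x-x_0\|\ge h_0.$$ Let $X_1,\dots,X_n$ be i.i.d. with density $f$, let $h>0$ be a bin size, and let $\hat x$ be the output of the Mono-scale Mode Hunting procedure (described in the context) applied to $X_1,\dots,X_n$ with bin size $h$. Then there is a constant $A>0$ depending only on the constants in the two displayed conditions (and on $f$, $d$) such that, for all $n$ and $h>0$, $\|\hat x-x_0\|\le Ah$ with probability at least $1-A\exp(-nh^{d+2\beta}/A)$.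
   Context: Throughout, $\|x\|=\max_i|x_i|$ denotes the sup-norm on $\mathbb{R}^d$. Mono-scale Mode Hunting with bin size $h$: for $k\in\mathbb{Z}^d$, the bin $k$ is the hypercube $[kh,(k+1)h)$ (coordinatewise), and its count is the number of sample points lying in it. For each $i$, let $k_i=\lfloor X_i/h\rfloor$ (coordinatewise floor), let $\hat k$ be a bin index $k_i$ with the largest count (maximizing over $i=1,\dots,n$), and return $\hat x:=\hat k h$. *)

(* Defs.v *)
From HB Require Import structures.
From mathcomp Require Import all_boot all_order all_algebra.
From mathcomp Require Import all_classical all_reals all_analysis.
Import Order.TTheory GRing.Theory Num.Theory.
Set Implicit Arguments. Unset Strict Implicit. Unset Printing Implicit Defensive.
Local Open Scope classical_set_scope.
Local Open Scope ring_scope.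

(* R^d is modelled as d.-tuple R, with the product (= Borel) sigma-algebra
   provided by MathComp-Analysis. *)

Definition supdist (R : realType) (d : nat) (x y : d.-tuple R) : R :=
  \big[Num.max/0]_(i < d) `|tnth x i - tnth y i|.

(* Lebesgue integral over R^d, written as the iterated integral
   int dx_1 ... int dx_d g(x_1,...,x_d) (Tonelli) of a nonnegative function. *)
Fixpoint lebesgue_int_Rd (R : realType) (d : nat) :
    (d.-tuple R -> \bar R) -> \bar R :=
  match d with
  | 0 => fun g => g [tuple]
  | d'.+1 => fun g =>
      (\int[@lebesgue_measure R]_x
         lebesgue_int_Rd (fun t : d'.-tuple R => g (cons_tuple x t)))%E
  end.

Definition probability_density (R : realType) (d : nat) (f : d.-tuple R -> R) :=
  measurable_fun setT f /\ (forall x, 0 <= f x) /\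
  lebesgue_int_Rd (fun t => (f t)%:E) = 1%E.

Definition has_density (R : realType) (d0 : measure_display)
    (Omega : measurableType d0) (P : probability Omega R) (d : nat)
    (X : Omega -> d.-tuple R) (f : d.-tuple R -> R) :=
  measurable_fun setT X /\
  forall B : set (d.-tuple R), measurable B ->
    P (X @^-1` B) = lebesgue_int_Rd (fun t => ((f t) * \1_B t)%:E).

Definition mutually_independent (R : realType) (d0 : measure_display)
    (Omega : measurableType d0) (P : probability Omega R) (d n : nat)
    (X : 'I_n -> Omega -> d.-tuple R) :=
  forall B : 'I_n -> set (d.-tuple R), (forall i, measurable (B i)) ->
    P [set w | forall i, B i (X i w)] = (\prod_(i < n) P (X i @^-1` B i))%E.

Definition bin_index (R : realType) (d : nat) (h : R) (x : d.-tuple R)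
  : d.-tuple int := map_tuple (fun y => Num.floor (y / h)) x.

Definition bin_count (R : realType) (d n : nat) (h : R)
    (x : 'I_n -> d.-tuple R) (k : d.-tuple int) : nat :=
  #|[set i : 'I_n | bin_index h (x i) == k]|.

Definition bin_corner (R : realType) (d : nat) (h : R) (k : d.-tuple int)
  : d.-tuple R := map_tuple (fun z : int => z%:~R * h) k.

(* the set of all possible outputs xhat = khat h of the procedure, where
   khat = k_i for some i maximizing the count of bin k_i (any tie-break) *)
Definition mode_hunting_outputs (R : realType) (d n : nat) (h : R)
    (x : 'I_n -> d.-tuple R) : set (d.-tuple R) :=
  [set y | exists i : 'I_n,
     (forall j : 'I_n, bin_count h x (bin_index h (x j))
                       <= bin_count h x (bin_index h (x i)))%N /\
     y = bin_corner h (bin_index h (x i))].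

(* Main.v *)
(** The bin [k0] of [x0] has probability at least [(f x0 - C0 h^beta) h^d], while
    a bin at index distance [j] from [k0] that meets the support has probability
    at most [(f x0 - c1 (j h)^beta) h^d].  For [j] larger than a constant the gap
    is of order [h^d (j h)^beta], so a Chernoff bound for the difference of the
    two counts, whose variance per sample is of order [h^d], shows that the far
    bin beats [k0] with probability at most [exp (- kappa T j^(2 beta))], where
    [T = n h^(d + 2 beta)].  There are too many bins to use the worst of these
    bounds for each of them, but because of the growth in [j] their sum over the
    lattice is at most [C exp (- kappa T / 2)] as soon as [T >= 1].  For [T < 1]
    the claimed lower bound is at most [0], and for [h >= h0] every bin meeting the
    support is within a constant multiple of [h] of [x0]. *)

Require Import Defs.
From HB Require Import structures.
From mathcomp Require Import all_boot all_order all_algebra.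
From mathcomp Require Import all_classical all_reals all_analysis.
From mathcomp Require Import measurable_realfun lra ring zify.
Import Order.TTheory GRing.Theory Num.Theory.
Local Open Scope classical_set_scope.
Local Open Scope ring_scope.

(** * Iterated Lebesgue integrals and the probability of a bin *)

(** The integral of a nonnegative function is a supremum over the simple functions below it, hence
    monotone for arbitrary functions. Iterated integrals can then be compared without examining the
    measurability of the inner ones. *)
Lemma ge0_le_integral_setT (d : measure_display) (T : measurableType d)
    (R : realType) (mu : {measure set T -> \bar R}) (f g : T -> \bar R) :
  (forall x, (0 <= f x)%E) -> (forall x, (f x <= g x)%E) ->
  (\int[mu]_x f x <= \int[mu]_x g x)%E.
Proof.
move=> f0 fg; rewrite !ge0_integralTE//; last first.
  by move=> x; exact: le_trans (f0 x) (fg x).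
apply: ereal_sup_le => _ [u uf <-]; exists u => //= x.
exact: le_trans (uf x) (fg x).
Qed.

Lemma lebesgue_int_Rd_ge0 (R : realType) (d : nat) (g : d.-tuple R -> \bar R) :
  (forall t, (0 <= g t)%E) -> (0 <= lebesgue_int_Rd g)%E.
Proof.
elim: d g => [|d IHd] g g0 /=; first exact: g0.
by apply: integral_ge0 => x _; apply: IHd.
Qed.

Lemma le_lebesgue_int_Rd (R : realType) (d : nat) (f g : d.-tuple R -> \bar R) :
  (forall t, (0 <= f t)%E) -> (forall t, (f t <= g t)%E) ->
  (lebesgue_int_Rd f <= lebesgue_int_Rd g)%E.
Proof.
elim: d f g => [|d IHd] f g f0 fg /=; first exact: fg.
apply: ge0_le_integral_setT => x; first exact: lebesgue_int_Rd_ge0.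
by apply: IHd => t.
Qed.

Lemma lebesgue_int_Rd0 (R : realType) (d : nat) :
  lebesgue_int_Rd (fun _ : d.-tuple R => 0%E) = 0%E.
Proof. by elim: d => //= d IHd; rewrite IHd integral0. Qed.

Lemma floor_div_eq (R : realType) (h x : R) (m : int) : 0 < h ->
  (Num.floor (x / h) == m) = (m%:~R * h <= x < (m + 1)%:~R * h).
Proof. by move=> h0; rewrite floor_eq ler_pdivlMr// ltr_pdivrMr. Qed.

(** The factor [c] is general so that the indicator of the first side of the bin can be absorbed
    into it before the induction hypothesis is applied to the other coordinates. *)
Lemma lebesgue_int_Rd_bin (R : realType) (d : nat) (h c : R)
    (k : d.-tuple int) : 0 < h -> 0 <= c ->
  lebesgue_int_Rd (fun t => (c * (bin_index h t == k)%:R)%:E) =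
  (c * h ^+ d)%:E.
Proof.
move=> h0; elim: d k c => [|d IHd] k c c0 /=.
  by rewrite (tuple0 k) (tuple0 (bin_index _ _)) eqxx expr0.
case/tupleP: k => m k.
have E x (t : d.-tuple R) : (bin_index h (cons_tuple x t) == [tuple of m :: k])
    = (Num.floor (x / h) == m) && (bin_index h t == k).
  by rewrite -!val_eqE /= eqseq_cons.
have mI : measurable (`[(m%:~R * h), ((m + 1)%:~R * h)[%classic : set R).
  exact: measurable_itv.
transitivity (\int[@lebesgue_measure R]_x ((c * h ^+ d)%:E *
    (\1_(`[(m%:~R * h), ((m + 1)%:~R * h)[%classic : set R) x)%:E))%E.
  apply: eq_integral => x _; under eq_fun do rewrite E.
  under eq_fun do rewrite -mulnb natrM mulrA.
  rewrite IHd ?mulr_ge0// -EFinM indicE; congr (_%:E).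
  rewrite mem_setE in_itv /= floor_div_eq//.
  by rewrite mulrAC.
rewrite ge0_integralZl_EFin//; last 2 first.
- by apply: measurableT_comp => //; exact: measurable_indic.
- by rewrite mulr_ge0// exprn_ge0// ltW.
rewrite integral_indic// setIT.
rewrite [X in (_ * X)%E](lebesgue_measure_itv
  `[(m%:~R * h), ((m + 1)%:~R * h)[) /= lte_fin.
rewrite ltr_pM2r// ltr_int ltrDl ltr01 -EFinB -EFinM; congr (_%:E).
rewrite rmorphD /= exprS; ring.
Qed.

Lemma measurable_bin (R : realType) (d : nat) (h : R) (k : d.-tuple int) :
  0 < h -> measurable [set t : d.-tuple R | bin_index h t = k].
Proof.
move=> h0.
have -> : [set t : d.-tuple R | bin_index h t = k] = \big[setI/setT]_(i < d)
    ((fun t : d.-tuple R => tnth t i) @^-1`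
      `[((tnth k i)%:~R * h), ((tnth k i + 1)%:~R * h)[%classic).
  rewrite -bigcap_seq; apply/seteqP; split => t /=.
    by move=> <- i _ /=; rewrite in_itv /= -floor_div_eq// tnth_map.
  move=> H; apply: eq_from_tnth => i; apply/eqP; rewrite tnth_map floor_div_eq//.
  by have := H i; rewrite /= in_itv /=; apply; rewrite mem_index_enum.
apply: bigsetI_measurable => i _.
rewrite -[X in measurable X]setTI; apply: (@measurable_tnth _ R d i) => //.
Qed.

Section density_of_bins.
Variables (R : realType) (d0 : measure_display) (Omega : measurableType d0).
Variables (P : probability Omega R) (d : nat) (X : Omega -> d.-tuple R).
Variables (f : d.-tuple R -> R) (h : R).
Hypotheses (f0 : forall x, 0 <= f x) (Xf : has_density P X f) (h0 : 0 < h).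

Lemma bin_prob_le (k : d.-tuple int) (m : R) : 0 <= m ->
  (forall x, bin_index h x = k -> f x <= m) ->
  (P (X @^-1` [set t | bin_index h t = k]) <= (m * h ^+ d)%:E)%E.
Proof.
move=> m0 fm; rewrite Xf.2; last exact: measurable_bin.
rewrite -(lebesgue_int_Rd_bin _ _ _ _ k)//; apply: le_lebesgue_int_Rd => t.
  by rewrite lee_fin mulr_ge0// indicE.
rewrite lee_fin indicE; case: eqP => [e|ne].
  by rewrite mem_set// !mulr1; exact: fm.
by rewrite memNset// !mulr0.
Qed.

Lemma bin_prob_ge (k : d.-tuple int) (m : R) :
  (forall x, bin_index h x = k -> m <= f x) ->
  ((m * h ^+ d)%:E <= P (X @^-1` [set t | bin_index h t = k]))%E.
Proof.
move=> fm; have [m0|m0] := leP 0 m; last first.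
  apply: (@le_trans _ _ 0%E); last exact: measure_ge0.
  by rewrite lee_fin mulr_le0_ge0// ?ltW// exprn_gt0.
rewrite Xf.2; last exact: measurable_bin.
rewrite -(lebesgue_int_Rd_bin _ _ _ _ k)//; apply: le_lebesgue_int_Rd => t.
  by rewrite lee_fin mulr_ge0.
rewrite lee_fin indicE; case: eqP => [e|ne].
  by rewrite mem_set// !mulr1; exact: fm.
by rewrite memNset// !mulr0.
Qed.

Lemma prob_off_support (B : set (d.-tuple R)) : measurable B ->
  (forall x, B x -> f x = 0) -> P (X @^-1` B) = 0%E.
Proof.
move=> mB fB; rewrite Xf.2// -[RHS](lebesgue_int_Rd0 R d); congr lebesgue_int_Rd.
apply/funext => t; rewrite indicE; case: (asboolP (B t)) => Bt.
  by rewrite fB// mul0r.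
by rewrite memNset// mulr0.
Qed.

End density_of_bins.

(** * Union bound and Chernoff bound for the counts of two bins *)

Lemma measure_union_bound (d : measure_display) (T : measurableType d)
    (R : realType) (mu : {measure set T -> \bar R}) (I : finType) (Q : pred I)
    (A : set T) (F : I -> set T) :
  measurable A -> (forall i, measurable (F i)) ->
  A `<=` \big[setU/set0]_(i | Q i) F i ->
  (mu A <= \sum_(i | Q i) mu (F i))%E.
Proof.
move=> mA mF AF.
have mU (s : seq I) : measurable (\big[setU/set0]_(i <- s | Q i) F i).
  by apply: bigsetU_measurable.
apply: (@le_trans _ _ (mu (\big[setU/set0]_(i | Q i) F i))).
  by apply: le_measure; rewrite ?inE.
elim: (index_enum I) => [|i s IHs]; first by rewrite !big_nil measure0.
rewrite !big_cons; case: ifP => // _.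
by apply: le_trans (leeD2l _ IHs); exact: measureU2.
Qed.

Section chernoff.
Variables (R : realType) (d0 : measure_display) (Omega : measurableType d0).
Variables (P : probability Omega R) (d n : nat).
Variables (X : 'I_n -> Omega -> d.-tuple R).
Hypothesis mX : forall i, measurable_fun setT (X i).
Hypothesis indepX : mutually_independent P X.

Variables (F : finType) (L : d.-tuple R -> F).
Hypothesis mL : forall x, measurable [set t | L t = x].

Let fiber (l : {ffun 'I_n -> F}) := [set w | forall i, L (X i w) = l i].

Let mfiber l : measurable (fiber l).
Proof.
have -> : fiber l =
    \big[setI/setT]_(i < n) (X i @^-1` [set t | L t = l i]).
  rewrite -bigcap_seq; apply/seteqP; split => w /=; first by move=> H i _.
  by move=> H i; apply: H => /=; rewrite mem_index_enum.
apply: bigsetI_measurable => i _.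
by rewrite -[X in measurable X]setTI; exact: mX.
Qed.

Let eventE (E : pred {ffun 'I_n -> F}) :
  [set w | E [ffun i => L (X i w)]] = \big[setU/set0]_(l | E l) fiber l.
Proof.
rewrite -bigcup_seq_cond; apply/seteqP; split => w /=.
  move=> Ew; exists [ffun i => L (X i w)] => /=; first by rewrite mem_index_enum.
  by move=> i; rewrite ffunE.
move=> [l /= /andP[_ El] lw]; suff -> : [ffun i => L (X i w)] = l by [].
by apply/ffunP => i; rewrite ffunE.
Qed.

Lemma measurable_label_event (E : pred {ffun 'I_n -> F}) :
  measurable [set w | E [ffun i => L (X i w)]].
Proof. by rewrite eventE; apply: bigsetU_measurable. Qed.

Variables p omega : F -> R.
Hypothesis pE : forall i x, P (X i @^-1` [set t | L t = x]) = (p x)%:E.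
Hypothesis p0 : forall x, 0 <= p x.
Hypothesis omega0 : forall x, 0 <= omega x.

(** Markov's inequality as a finite sum: a label vector has probability [\prod_i p (l i)] by
    independence, the weight [\prod_i omega (l i)] is at least [1] on [E], and the weighted sum over
    all label vectors factors into an [n]-th power. *)
Lemma chernoff_labels (E : pred {ffun 'I_n -> F}) :
  (forall l, E l -> 1 <= \prod_i omega (l i)) ->
  (P [set w | E [ffun i => L (X i w)]] <= ((\sum_x p x * omega x) ^+ n)%:E)%E.
Proof.
move=> Eomega; apply: (@le_trans _ _ (\sum_(l | E l) P (fiber l))%E).
  by apply: measure_union_bound => //; [exact: measurable_label_event|rewrite eventE].
have -> : (\sum_(l | E l) P (fiber l) =
    (\sum_(l | E l) \prod_(i < n) p (l i))%:E)%E.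
  rewrite -sumEFin; apply: eq_bigr => l _.
  have /= -> := indepX (fun i => [set t | L t = l i]) (fun i => mL _).
  by rewrite -prodEFin; apply: eq_bigr => i _; rewrite pE.
rewrite lee_fin.
have -> : (\sum_x p x * omega x) ^+ n = \prod_(i < n) \sum_x p x * omega x.
  by rewrite prodr_const card_ord.
rewrite bigA_distr_bigA /=.
rewrite big_mkcond /=; apply: ler_sum => l _.
rewrite big_split /=; case: ifP => El.
  by rewrite ler_peMr ?Eomega// prodr_ge0.
by rewrite mulr_ge0// prodr_ge0.
Qed.

End chernoff.

(* The left-hand side is the expectation of [s ^ (1_k - 1_k0)] for two bins of
   probabilities [a] and [b], with [s = 1 + e] and [e = D / (2 Q)]; minus [1], it
   is at most [e / (1 + e) * (e Q - D)]. *)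
Lemma exponential_moment_le (R : realType) (a b D Q : R) :
  0 <= a -> a <= Q -> 0 <= D -> D <= b - a -> D <= 2 * Q -> 0 < Q ->
  a * (1 + D / (2 * Q)) + b * (1 + D / (2 * Q))^-1 + (1 - a - b) <=
  expR (- (D ^+ 2 / (8 * Q))).
Proof.
move=> a0 aQ D0 Dba DQ Q0; apply: le_trans (expR_ge1Dx _).
set s := 1 + _.
set e := D / (2 * Q).
have e0 : 0 <= e by rewrite divr_ge0// ltW// mulr_gt0.
have e1 : e <= 1 by rewrite ler_pdivrMr ?mul1r// mulr_gt0.
have De : D = 2 * Q * e by rewrite /e; field; rewrite gt_eqF.
have s0 : 0 < s by rewrite /s -/e; lra.
have -> : D ^+ 2 / (8 * Q) = Q * e ^+ 2 / 2.
  by rewrite De; field; rewrite gt_eqF.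
have -> : a * s + b * s^-1 + (1 - a - b) = 1 + (e * (a * s - b)) / s.
  by rewrite /s -/e; field; rewrite gt_eqF.
rewrite lerD2l ler_pdivrMr// /s -/e.
(* This adds [a * e <= Q * e] and [a - b <= - D = - 2 Q e]; the conclusion then follows from
   [s <= 2]. *)
have : a * (1 + e) - b <= - (Q * e) by nra.
nra.
Qed.

Lemma bin_countE (R : realType) (d n : nat) (h : R) (x : 'I_n -> d.-tuple R)
    (k : d.-tuple int) :
  bin_count h x k = #|[pred i | bin_index h (x i) == k]|.
Proof. by apply: eq_card => i; rewrite inE /=; apply/asboolP/idP. Qed.

(** Sample points are labelled by membership in [k], in [k0] or in neither, with weights [s], [s^-1]
    and [1]. The total weight is [s] to the power of the difference of the two counts, hence at
    least [1] on the event. *)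
Lemma prob_count_ge (R : realType) (d0 : measure_display)
    (Omega : measurableType d0) (P : probability Omega R) (d n : nat)
    (X : 'I_n -> Omega -> d.-tuple R) (h a b D Q : R) (k k0 : d.-tuple int) :
  0 < h -> (forall i, measurable_fun setT (X i)) -> mutually_independent P X ->
  k != k0 ->
  (forall i, P (X i @^-1` [set t | bin_index h t = k]) = a%:E) ->
  (forall i, P (X i @^-1` [set t | bin_index h t = k0]) = b%:E) ->
  0 <= a -> a <= Q -> 0 <= D -> D <= b - a -> D <= 2 * Q -> 0 < Q ->
  (P [set w | (bin_count h (X^~ w) k0 <= bin_count h (X^~ w) k)%N] <=
   (expR (- (n%:R * (D ^+ 2 / (8 * Q)))))%:E)%E.
Proof.
move=> h0 mX indepX kk0 Pa Pb a0 aQ D0 Dba DQ Q0.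
pose L t := if bin_index h t == k then Some true else
            if bin_index h t == k0 then Some false else None.
have Lk : [set t | L t = Some true] = [set t : d.-tuple R | bin_index h t = k].
  apply/seteqP; split => t /=; rewrite /L; last by move=> ->; rewrite eqxx.
  by case: ifP => [/eqP//|_]; case: ifP.
have Lk0 : [set t | L t = Some false] =
    [set t : d.-tuple R | bin_index h t = k0].
  apply/seteqP; split => t /=; rewrite /L.
    by case: ifP => // _; case: eqP.
  by move=> ->; rewrite eq_sym (negbTE kk0) eqxx.
have LN : [set t | L t = None] = ~` ([set t | L t = Some true] `|`
    [set t | L t = Some false]).
  apply/seteqP; split => t /=; first by move=> ->; case.
  by case: (L t) => // -[] []; [left|right].
have mL x : measurable [set t | L t = x].
  have mt : measurable [set t | L t = Some true].
    by rewrite Lk; exact: measurable_bin.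
  have mf : measurable [set t | L t = Some false].
    by rewrite Lk0; exact: measurable_bin.
  by case: x => [[]|] //; rewrite LN; apply: measurableC; exact: measurableU.
pose E (l : {ffun 'I_n -> option bool}) :=
  (#|[pred i | l i == Some false]| <= #|[pred i | l i == Some true]|)%N.
have EE : [set w | (bin_count h (X^~ w) k0 <= bin_count h (X^~ w) k)%N] =
    [set w | E [ffun i => L (X i w)]].
  have c1 w : bin_count h (X^~ w) k =
      #|[pred i | [ffun i => L (X i w)] i == Some true]|.
    rewrite bin_countE; apply: eq_card => i; rewrite !inE ffunE.
    by apply/eqP/eqP => H; have := congr1 (fun S => S (X i w)) Lk => /= e;
      [rewrite e|rewrite -e].
  have c2 w : bin_count h (X^~ w) k0 =
      #|[pred i | [ffun i => L (X i w)] i == Some false]|.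
    rewrite bin_countE; apply: eq_card => i; rewrite !inE ffunE.
    by apply/eqP/eqP => H; have := congr1 (fun S => S (X i w)) Lk0 => /= e;
      [rewrite e|rewrite -e].
  by apply/seteqP; split => w /=; rewrite /E c1 c2.
rewrite EE.
(* The nonnegativity of [1 - a - b] is read off below from the law of a sample point, so the empty
   sample is treated apart; its bound is [1]. *)
case: (posnP n) => [n0|n0].
  apply: le_trans (probability_le1 _ _) _; first exact: measurable_label_event.
  by rewrite n0 mul0r oppr0 expR0.
pose p (x : option bool) : R :=
  if x is Some true then a else if x is Some false then b else 1 - a - b.
pose s := 1 + D / (2 * Q).
pose omega (x : option bool) : R :=
  if x is Some true then s else if x is Some false then s^-1 else 1.
have s1 : 1 <= s by rewrite /s lerDl divr_ge0// ltW// mulr_gt0.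
have s0 : 0 < s by apply: lt_le_trans s1.
have mXi i x : measurable (X i @^-1` [set t | L t = x]).
  by rewrite -[X in measurable X]setTI; exact: mX.
have pE i x : P (X i @^-1` [set t | L t = x]) = (p x)%:E.
  case: x => [[]|] /=; rewrite ?Lk ?Lk0 //.
  rewrite LN -preimage_setC probability_setC; last first.
    by rewrite preimage_setU; exact: measurableU.
  have PU : P (X i @^-1` [set t | L t = Some true] `|`
               X i @^-1` [set t | L t = Some false]) =
      (P (X i @^-1` [set t | L t = Some true]) +
       P (X i @^-1` [set t | L t = Some false]))%E.
    by apply: measureU => //; apply/seteqP; split => // w /= [-> ].
  rewrite preimage_setU PU Lk Lk0 Pa Pb.
  by transitivity ((1 - (a + b))%:E) => //=; rewrite opprD addrA.
have p0 x : 0 <= p x by rewrite -lee_fin -(pE (Ordinal n0)).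
apply: (le_trans (@chernoff_labels _ _ _ P _ _ X mX indepX _ L mL p omega pE p0 _ E _)).
- by case=> [[]|]//=; rewrite ?invr_ge0 ltW.
- move=> l El.
  have -> : \prod_i omega (l i) =
     \prod_i ((if l i == Some true then s else 1) *
              (if l i == Some false then s^-1 else 1)).
    by apply: eq_bigr => i _; case: (l i) => [[]|] /=; rewrite ?mulr1 ?mul1r.
  rewrite big_split /= -!big_mkcond /= !prodr_const.
  rewrite exprVn ler_pdivlMr ?exprn_gt0// mul1r.
  apply: ler_weXn2l => //.
rewrite lee_fin.
have -> : \sum_x p x * omega x = a * s + b * s^-1 + (1 - a - b).
  rewrite (bigD1 (Some true))//= (bigD1 (Some false))//= (bigD1 None)//=.
  rewrite big1; first by rewrite addr0 mulr1 addrA.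
  by case=> [[]|].
rewrite -mulrN expRM_natl; apply: lerXn2r; rewrite ?nnegrE ?expR_ge0//.
  have := p0 None; have := p0 (Some false) => /= ? ?.
  apply: addr_ge0 => //.
  by apply: addr_ge0; apply: mulr_ge0; rewrite ?invr_ge0 ?(ltW s0).
exact: exponential_moment_le.
Qed.

(** * Sup-norm geometry of bins *)

Section sup_distance.
Variables (R : realType) (d : nat).
Implicit Types x y : d.-tuple R.

Lemma supdist_le x y (M : R) : 0 <= M ->
  (forall i, `|tnth x i - tnth y i| <= M) -> supdist x y <= M.
Proof. by move=> M0 H; apply: bigmax_le. Qed.

Lemma le_supdist x y i : `|tnth x i - tnth y i| <= supdist x y.
Proof. exact: (le_bigmax _ (fun i => `|tnth x i - tnth y i|)). Qed.

Lemma supdist_ge0 x y : 0 <= supdist x y.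
Proof. exact: bigmax_ge_id. Qed.

End sup_distance.

Definition index_dist {d : nat} (k k' : d.-tuple int) : nat :=
  \max_(i < d) `|tnth k i - tnth k' i|%N.

Section bin_geometry.
Variables (R : realType) (d : nat) (h : R).
Hypothesis h0 : 0 < h.
Implicit Types (x y : d.-tuple R) (k : d.-tuple int).

Lemma bin_index_bounds x i : (tnth (bin_index h x) i)%:~R * h <= tnth x i /\
  tnth x i < (tnth (bin_index h x) i)%:~R * h + h.
Proof.
rewrite tnth_map.
have /eqP := erefl (Num.floor (tnth x i / h)); rewrite floor_div_eq//.
by rewrite rmorphD /= mulrDl mul1r => /andP[].
Qed.

Lemma bin_corner_dist x : supdist (bin_corner h (bin_index h x)) x <= h.
Proof.
apply: supdist_le => [|i]; first exact: ltW.
have [H1 H2] := bin_index_bounds x i.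
by rewrite [tnth (bin_corner _ _) i]tnth_map ler_norml; apply/andP; split; lra.
Qed.

Lemma same_bin_supdist x y : bin_index h x = bin_index h y -> supdist x y <= h.
Proof.
move=> xy; apply: supdist_le => [|i]; first exact: ltW.
have [H1 H2] := bin_index_bounds x i; have [] := bin_index_bounds y i.
by rewrite -xy ler_norml => H3 H4; apply/andP; split; lra.
Qed.

(** In a coordinate where the indices differ most, the corners are [index_dist] times [h] apart.
    Each point exceeds its corner by less than [h], so the two excesses together change the distance
    by less than one bin side. *)
Lemma bin_supdist_ge x y :
  ((index_dist (bin_index h x) (bin_index h y))%:R - 1) * h <= supdist x y.
Proof.
(* A positive index distance rules out [d = 0], so some coordinate attains the maximum. *)
case: (posnP (index_dist (bin_index h x) (bin_index h y))) => [->|p0].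
  by rewrite sub0r mulN1r (le_trans _ (supdist_ge0 _ _ _ _))// oppr_le0 ltW.
have [i Ei] : exists i, index_dist (bin_index h x) (bin_index h y) =
    `|tnth (bin_index h x) i - tnth (bin_index h y) i|%N.
  case: (posnP #|'I_d|) => [d0|d0].
    move: p0; rewrite /index_dist big1// => i _.
    by have := card0_eq d0 i; rewrite inE.
  have [i Ei] := bigop.eq_bigmax (fun i : 'I_d =>
      `|tnth (bin_index h x) i - tnth (bin_index h y) i|%N) d0.
  by exists i.
rewrite Ei; apply: le_trans (le_supdist _ _ x y i).
have [H1 H2] := bin_index_bounds x i; have [H3 H4] := bin_index_bounds y i.
rewrite natr_absz intr_norm rmorphB /=.
set u := (tnth _ i)%:~R; set v := (tnth _ i)%:~R.
move: H1 H2 H3 H4; rewrite -/u -/v => H1 H2 H3 H4.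
rewrite mulrBl mul1r -{1}(gtr0_norm h0) -normrM mulrBl.
set X := tnth x i in H1 H2 *; set Y := tnth y i in H3 H4 *.
have [Z1|Z1] := leP 0 (u * h - v * h); have [Z2|Z2] := leP 0 (X - Y).
- rewrite (ger0_norm Z1) (ger0_norm Z2); lra.
- rewrite (ger0_norm Z1) (ltr0_norm Z2); lra.
- rewrite (ltr0_norm Z1) (ger0_norm Z2); lra.
- rewrite (ltr0_norm Z1) (ltr0_norm Z2); lra.
Qed.

Lemma bin_corner_supdist_le k y : supdist (bin_corner h k) y <=
  ((index_dist k (bin_index h y))%:R + 1) * h.
Proof.
apply: supdist_le => [|i]; first by rewrite mulr_ge0 ?addr_ge0// ltW.
rewrite [tnth (bin_corner _ _) i]tnth_map.
have [H3 H4] := bin_index_bounds y i.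
have : (`|tnth k i - tnth (bin_index h y) i|%N%:R : R) <=
    (index_dist k (bin_index h y))%:R.
  rewrite ler_nat.
  exact: (leq_bigmax (F := fun i => `|tnth k i - tnth (bin_index h y) i|%N)).
rewrite natr_absz intr_norm rmorphB /=.
set u := (tnth k i)%:~R; set v := (tnth _ i)%:~R; set J := _%:R.
rewrite -/v in H3 H4.
move=> H; have {H} := ler_wpM2r (ltW h0) H.
rewrite -{1}(gtr0_norm h0) -normrM mulrBl mulrDl mul1r.
rewrite !ler_norml => /andP[H1 H2]; apply/andP; split; lra.
Qed.

End bin_geometry.

(** * A finite enumeration of the bins around a given bin *)

Section shifted_bins.
Context {d N : nat}.
Implicit Types (k : d.-tuple int) (g : {ffun 'I_d -> 'I_N.+1 * bool}).

(** Each coordinate of the offset is encoded by absolute value and sign. Offset [0] is encoded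
    twice, which only enlarges a union bound, and the function type lets sums factor over the
    coordinates. *)
Definition shift_bin k g : d.-tuple int :=
  [tuple tnth k i + (if (g i).2 then ((g i).1 : nat)%:Z
                     else - ((g i).1 : nat)%:Z) | i < d].

Definition shift_norm g : nat := \max_(i < d) (g i).1.

Lemma index_dist_shift k g : index_dist (shift_bin k g) k = shift_norm g.
Proof.
apply: eq_bigr => i _; rewrite tnth_mktuple addrC addKr.
by case: ifP => _; rewrite ?abszN absz_nat.
Qed.

Lemma shift_bin_surj k k' : (index_dist k' k <= N)%N ->
  exists g, shift_bin k g = k'.
Proof.
move=> kN; pose z i := tnth k' i - tnth k i.
have zN i : (`|z i| <= N)%N.
  by apply: leq_trans kN; exact: (leq_bigmax (F := fun i => `|z i|%N)).
exists [ffun i => (inord `|z i|%N, 0 <= z i)].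
apply: eq_from_tnth => i; rewrite tnth_mktuple ffunE /= inordK ?ltnS//.
have -> : (if 0 <= z i then `|z i|%N%:Z else - `|z i|%N%:Z) = z i.
  by case: ifP => z0; lia.
by rewrite addrC subrK.
Qed.

End shifted_bins.

(** * Uniform bounds for exponential sums over the lattice *)

Section lattice_sums.
Variable R : realType.

Lemma sum_inv_sq_le (N : nat) : \sum_(i < N.+1) (1 + i%:R : R) ^- 2 <= 2.
Proof.
(* The sharper bound telescopes, since [(t + 1) ^- 2 <= t^-1 - (t + 1)^-1]. *)
suff H : \sum_(i < N.+1) (1 + i%:R : R) ^- 2 <= 2 - (1 + N%:R)^-1.
  by apply: le_trans H _; rewrite gerBl invr_ge0 addr_ge0.
elim: N => [|N IHN]; first by rewrite big_ord_recr big_ord0 /= addr0; lra.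
rewrite big_ord_recr /=; apply: le_trans (lerD IHN (lexx _)) _.
set t : R := 1 + N%:R; have t0 : 0 < t by rewrite ltr_pwDl ?ltr01 ?ler0n.
have -> : 1 + N.+1%:R = t + 1 :> R by rewrite -natr1 addrA.
have -> : 2 - t^-1 + (t + 1) ^- 2 =
    2 - (t + 1)^-1 - (t * (t + 1) ^+ 2)^-1.
  by field; rewrite !gt_eqF// addr_gt0.
rewrite gerBl invr_ge0; apply: mulr_ge0; first exact: ltW.
by rewrite exprn_ge0// addr_ge0// ltW.
Qed.

Lemma expR_ge_pow (x : R) (m : nat) : 0 <= x -> (x / m.+1%:R) ^+ m.+1 <= expR x.
Proof.
move=> x0; have E : x = m.+1%:R * (x / m.+1%:R) by field; rewrite addrC natr1 pnatr_eq0.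
rewrite {2}E expRM_natl; apply: lerXn2r; rewrite ?nnegrE ?expR_ge0 ?divr_ge0//.
by apply: le_trans (expR_ge1Dx _); rewrite lerDr.
Qed.

(** [M] satisfies [b * M.+1 >= m], so the power [M.+1] in [expR_ge_pow] already grows at least like
    [j ^+ m]; replacing [1 + j] by [2 * j] costs the factor [2 ^+ m]. *)
Lemma expRN_powR_le (a b : R) (m : nat) : 0 < a -> 0 < b ->
  exists2 C : R, 0 < C & forall j : nat, (0 < j)%N ->
    expR (- (a * j%:R `^ b)) <= C * (1 + j%:R) ^- m.
Proof.
move=> a0 b0; pose M := Num.truncn (m%:R / b).
have Mb : m%:R <= b * M.+1%:R.
  by rewrite mulrC -ler_pdivrMr// ltW// truncnS_gt.
have M0 : 0 < M.+1%:R :> R by rewrite ltr0n.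
exists (2 ^+ m * (M.+1%:R / a) ^+ M.+1).
  by rewrite mulr_gt0 ?exprn_gt0// divr_gt0.
move=> j j0; have j1 : 1 <= j%:R :> R by rewrite ler1n.
have jj : 0 < 1 + j%:R :> R by rewrite ltr_wpDr.
have H : (a * j%:R `^ b / M.+1%:R) ^+ M.+1 <= expR (a * j%:R `^ b).
  by apply: expR_ge_pow; rewrite mulr_ge0 ?powR_ge0 ?ltW.
have K : (1 + j%:R) ^+ m <= 2 ^+ m * (j%:R `^ b) ^+ M.+1 :> R.
  apply: (@le_trans _ _ (2 ^+ m * j%:R ^+ m)).
    by rewrite -exprMn; apply: lerXn2r; rewrite ?nnegrE; lra.
  rewrite ler_pM2l ?exprn_gt0//.
  rewrite -[X in _ <= X]powR_mulrn ?powR_ge0// -powRrM -[X in X <= _]powR_mulrn ?ler0n//.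
  exact: ler_powR.
rewrite expRN ler_pdivlMr ?exprn_gt0// ler_pdivrMl ?expR_gt0//.
apply: (le_trans K); rewrite mulrCA ler_pM2l ?exprn_gt0//.
apply: (@le_trans _ _ ((a * j%:R `^ b / M.+1%:R) ^+ M.+1 * (M.+1%:R / a) ^+ M.+1)).
  rewrite -exprMn; apply: lerXn2r; rewrite ?nnegrE ?powR_ge0//.
    by rewrite mulr_ge0 ?divr_ge0 ?mulr_ge0 ?powR_ge0 ?ltW.
  by rewrite le_eqVlt; apply/orP; left; apply/eqP; field; rewrite addrC natr1 !gt_eqF.
by rewrite ler_pM2r// exprn_gt0// divr_gt0.
Qed.

(* The bins at index distance [j] number about [j ^ (d - 1)], which the decay
   of [expR (- (a * j `^ b))] beats; dominating by a product of inverse squares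
   makes the sum over the lattice factor. *)
Lemma sum_shift_expR_bounded (a b : R) (d : nat) : 0 < a -> 0 < b ->
  exists2 C : R, 0 < C & forall N : nat,
    \sum_(g : {ffun 'I_d -> 'I_N.+1 * bool} | (0 < shift_norm g)%N)
      expR (- (a * (shift_norm g)%:R `^ b)) <= C.
Proof.
move=> a0 b0; have [C C0 HC] := expRN_powR_le a b (2 * d)%N a0 b0.
(* Each coordinate contributes at most [4]: two signs times the bound [2] on the sum of inverse
   squares. *)
exists (C * 4 ^+ d); first by rewrite mulr_gt0// exprn_gt0.
move=> N; pose w (x : 'I_N.+1 * bool) : R := (1 + (x.1 : nat)%:R) ^- 2.
have w0 x : 0 <= w x by rewrite invr_ge0 exprn_ge0// addr_ge0.
apply: (@le_trans _ _ (\sum_(g : {ffun 'I_d -> 'I_N.+1 * bool})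
    C * \prod_(i < d) w (g i))).
  rewrite big_mkcond /=; apply: ler_sum => g _; case: ifP => g0; last first.
    by rewrite mulr_ge0 ?(ltW C0)// prodr_ge0.
  apply: le_trans (HC _ g0) _; rewrite ler_pM2l//.
  have -> : (1 + (shift_norm g)%:R : R) ^- (2 * d) =
      \prod_(i < d) (1 + (shift_norm g)%:R) ^- 2.
    by rewrite prodr_const card_ord exprVn exprM.
  apply: ler_prod => i _; rewrite invr_ge0 exprn_ge0 ?addr_ge0//= /w.
  rewrite lef_pV2 ?posrE ?exprn_gt0 ?ltr_pwDl//.
  apply: lerXn2r; rewrite ?nnegrE ?addr_ge0// lerD2l ler_nat.
  exact: (leq_bigmax (F := fun i => (g i).1 : nat)).
rewrite -mulr_sumr ler_pM2l// -(bigA_distr_bigA (fun _ => w)) /=.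
rewrite prodr_const card_ord; apply: lerXn2r; rewrite ?nnegrE ?sumr_ge0//.
have -> : \sum_x w x = \sum_(i < N.+1) \sum_(c : bool) (1 + (i : nat)%:R) ^- 2.
  by rewrite pair_big.
under eq_bigr do rewrite sumr_const card_bool.
rewrite sumrMnl; have := sum_inv_sq_le N; set S := \sum_(_ < _) _.
by move=> H; rewrite mulr2n; lra.
Qed.

End lattice_sums.

(** * Measurability of the events in the sample *)

Section bin_events.
Variables (R : realType) (d0 : measure_display) (Omega : measurableType d0).
Variables (d n : nat) (h : R) (X : 'I_n -> Omega -> d.-tuple R).
Hypotheses (h0 : 0 < h) (mX : forall i, measurable_fun setT (X i)).

(** The vector of bin indices ranges over a countable set, so even for arbitrary [S] the event is a
    countable union of finite intersections of bin events. *)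
Lemma measurable_bin_event (S : set {ffun 'I_n -> d.-tuple int}) :
  measurable [set w | S [ffun i => bin_index h (X i w)]].
Proof.
pose F g := [set w | S g /\ forall i, bin_index h (X i w) = g i].
have -> : [set w | S [ffun i => bin_index h (X i w)]] = \bigcup_g F g.
  apply/seteqP; split => w /=.
    move=> Sw; exists [ffun i => bin_index h (X i w)] => //; split => // i.
    by rewrite ffunE.
  move=> [g _ [Sg gw]]; suff -> : [ffun i => bin_index h (X i w)] = g by [].
  by apply/ffunP => i; rewrite ffunE.
apply: countable_bigcupT_measurable => [|g]; first exact: countableP.
have [Sg|nSg] := pselect (S g); last first.
  by rewrite (_ : F g = set0)//; apply/seteqP; split => // w [].
have -> : F g = \big[setI/setT]_(i < n)
    (X i @^-1` [set t | bin_index h t = g i]).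
  rewrite -bigcap_seq; apply/seteqP; split => w /=; first by move=> [_ H] i _.
  by move=> H; split=> // i; apply: H => /=; rewrite mem_index_enum.
apply: bigsetI_measurable => i _; rewrite -[X in measurable X]setTI.
by apply: mX => //; exact: measurable_bin.
Qed.

Let cE w k : #|[pred i | [ffun i => bin_index h (X i w)] i == k]| =
  bin_count h (X^~ w) k.
Proof. by rewrite bin_countE; apply: eq_card => i; rewrite !inE ffunE. Qed.

Lemma measurable_count_event (k k0 : d.-tuple int) :
  measurable [set w | (bin_count h (X^~ w) k0 <= bin_count h (X^~ w) k)%N].
Proof.
have := measurable_bin_event [set g : {ffun 'I_n -> d.-tuple int} |
  (#|[pred i | g i == k0]| <= #|[pred i | g i == k]|)%N].
by congr measurable; apply/seteqP; split => w /=; rewrite !cE.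
Qed.

(** Counts and outputs depend on the sample only through its bin indices, so the quantification over
    outputs becomes a condition on the index vector. *)
Lemma measurable_output_event (G : set (d.-tuple R)) :
  measurable [set w | forall y, mode_hunting_outputs h (X^~ w) y -> G y].
Proof.
have := measurable_bin_event [set g : {ffun 'I_n -> d.-tuple int} |
  forall i, (forall j, (#|[pred l | g l == g j]| <= #|[pred l | g l == g i]|)%N) ->
  G (bin_corner h (g i))].
congr measurable; apply/seteqP; split => w /= H.
  move=> y [i [Hi ->]]; have := H i; rewrite ffunE; apply=> j.
  by rewrite !ffunE !cE.
move=> i Hi; rewrite ffunE; apply: H; exists i; split => // j.
by have := Hi j; rewrite !ffunE !cE.
Qed.

End bin_events.

(** For [D >= 0] this is the complement of a closed sup-norm ball; the coordinatewise form makes it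
    visibly a finite union of measurable sets. *)
Definition off_cube {R : realType} {d : nat} (x0 : d.-tuple R) (D : R)
  : set (d.-tuple R) := [set x | exists i, D < `|tnth x i - tnth x0 i|].

Lemma measurable_off_cube (R : realType) (d : nat) (x0 : d.-tuple R) (D : R) :
  measurable (off_cube x0 D).
Proof.
have -> : off_cube x0 D =
    \big[setU/set0]_(i < d) ((fun x : d.-tuple R => tnth x i) @^-1`
      ((fun r : R => `|r - tnth x0 i|) @^-1` `]D, +oo[%classic)).
  rewrite -bigcup_seq; apply/seteqP; split => x /=.
    by move=> [i Di]; exists i => /=; rewrite ?mem_index_enum ?in_itv /= ?Di.
  by move=> [i _ /=]; rewrite in_itv /= andbT => Di; exists i.
apply: bigsetU_measurable => i _.
have mn : measurable_fun setT (fun r : R => `|r - tnth x0 i|).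
  by apply: measurableT_comp => //; apply: measurable_funB.
rewrite -[X in measurable X]setTI; apply: (@measurable_tnth _ R d i) => //.
by rewrite -[X in measurable X]setTI; apply: mn => //; exact: measurable_itv.
Qed.

(** * Density gap between the mode and the far bins *)

Section mode.
Variables (R : realType) (d : nat) (f : d.-tuple R -> R) (x0 : d.-tuple R).
Variables c0 C0 h0 beta D : R.
Hypothesis f_ge0 : forall x, 0 <= f x.
Hypothesis f_le : forall x, f x <= f x0.
Hypothesis fx0_gt0 : 0 < f x0.
Hypothesis c0_gt0 : 0 < c0.
Hypothesis C0_gt0 : 0 < C0.
Hypothesis h0_gt0 : 0 < h0.
Hypothesis beta_gt0 : 0 < beta.
Hypothesis f_near : forall x, supdist x x0 <= h0 ->
  f x0 - C0 * supdist x x0 `^ beta <= f x /\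
  f x <= f x0 - c0 * supdist x x0 `^ beta.
Hypothesis f_far : forall x, h0 <= supdist x x0 -> f x <= f x0 - c0 * h0 `^ beta.
Hypothesis h0D : h0 <= D.
Hypothesis f_off : forall x, off_cube x0 D x -> f x = 0.

(** Scaling by [h0 / (2 * D)] brings every length up to [2 * D] down to at most [h0], so this single
    growth constant serves on the whole cube. *)
Let c1 : R := c0 * (h0 / (2 * D)) `^ beta.
Let D_gt0 : 0 < D. Proof. exact: lt_le_trans h0D. Qed.
Let c1_gt0 : 0 < c1.
Proof. by rewrite mulr_gt0// powR_gt0// divr_gt0// mulr_gt0. Qed.

(** As [j >= 2], the distance from [x] to [x0] is at least [(j - 1) h >= j h / 2]. The rescaled
    length [q] lies below both this distance and [h0], so it fits into the near bound or the far
    bound, whichever applies to [x]. *)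
Lemma far_bin_density (h : R) (x : d.-tuple R) (j : nat) : 0 < h ->
  j = index_dist (bin_index h x) (bin_index h x0) -> (2 <= j)%N ->
  j%:R * h <= 2 * D -> f x <= f x0 - c1 * (j%:R * h) `^ beta.
Proof.
move=> h_gt0 jE j2 jD; have := bin_supdist_ge R d h h_gt0 x x0; rewrite -jE.
have {}j2 : 2 <= j%:R :> R by rewrite (ler_nat _ 2).
set r := supdist x x0 => jr.
have jh2 : j%:R * h / 2 <= r by nra.
pose q := h0 / (2 * D) * (j%:R * h).
have q_ge0 : 0 <= q.
  by rewrite mulr_ge0 ?divr_ge0 ?mulr_ge0 ?(ltW D_gt0) ?(ltW h0_gt0) ?(ltW h_gt0).
have qh0 : q <= h0.
  by rewrite /q mulrAC ler_pdivrMr ?mulr_gt0// ler_pM2l.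
have qr : q <= r.
  apply: le_trans jh2; rewrite /q mulrAC ler_pdivrMr ?mulr_gt0//.
  have z0 : 0 <= j%:R * h by rewrite mulr_ge0// ltW.
  by have := ler_wpM2r z0 h0D; lra.
have -> : c1 * (j%:R * h) `^ beta = c0 * q `^ beta.
  rewrite /q [in RHS]powRM ?mulrA//.
    by rewrite divr_ge0 ?mulr_ge0 ?(ltW D_gt0) ?(ltW h0_gt0).
  by rewrite mulr_ge0// ltW.
have mono u : q <= u -> c0 * q `^ beta <= c0 * u `^ beta.
  move=> qu; rewrite ler_pM2l//; apply: ge0_ler_powR; rewrite ?nnegrE ?(ltW beta_gt0)//.
  exact: le_trans qu.
have [rh|hr] := leP r h0.
  apply: le_trans (f_near _ rh).2 _; rewrite lerD2l lerN2; exact: mono.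
apply: le_trans (f_far _ (ltW hr)) _; rewrite lerD2l lerN2; exact: mono.
Qed.

(** The constant left when the gap [c1 / 2 * (j h)^beta * h^d] and the scale [Q = f x0 * h^d] are
    inserted into the exponent of [prob_count_ge]. *)
Let kappa : R := c1 ^+ 2 / (32 * f x0).
Let kappa_gt0 : 0 < kappa.
Proof. by apply: divr_gt0; [exact: exprn_gt0|exact: mulr_gt0]. Qed.

(** * Probability of an output far from the mode *)

Section sample.
Variables (d0 : measure_display) (Omega : measurableType d0).
Variables (P : probability Omega R) (n : nat) (h : R).
Variable X : 'I_n -> Omega -> d.-tuple R.
Hypothesis h_gt0 : 0 < h.
Hypothesis Xf : forall i, has_density P (X i) f.
Hypothesis indepX : mutually_independent P X.

Let T : R := n%:R * h `^ (d%:R + 2 * beta).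
Let k0 := bin_index h x0.

(** Relative to [f x0], the density loses at most [C0 h^beta] on the bin [k0] and at least
    [c1 (j h)^beta] on the bin [k]. The lower bound on [j^beta] makes the first loss at most half of
    the second, which leaves the gap required by [prob_count_ge]. *)
Lemma far_bin_prob (k : d.-tuple int) : (0 < n)%N -> h <= h0 ->
  (2 <= index_dist k k0)%N -> (index_dist k k0)%:R * h <= 2 * D ->
  2 * C0 / c1 <= (index_dist k k0)%:R `^ beta ->
  (P [set w | (bin_count h (X^~ w) k0 <= bin_count h (X^~ w) k)%N] <=
   (expR (- (kappa * T * (index_dist k k0)%:R `^ (2 * beta))))%:E)%E.
Proof.
move=> n_gt0 hh0; set j := index_dist k k0 => j2 jD jC.
pose i0 := Ordinal n_gt0.
pose p k' := fine (P (X i0 @^-1` [set t | bin_index h t = k'])).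
have mbin k' := measurable_bin R d h k' h_gt0.
have mXb i k' : measurable (X i @^-1` [set t | bin_index h t = k']).
  by rewrite -[X in measurable X]setTI; exact: (Xf i).1.
have pE i k' : P (X i @^-1` [set t | bin_index h t = k']) = (p k')%:E.
  rewrite /p fineK; last exact: fin_num_measure.
  by rewrite (Xf i).2// (Xf i0).2.
have p_ge0 k' : 0 <= p k' by rewrite -lee_fin -(pE i0).
have hd : 0 < h ^+ d by rewrite exprn_gt0.
have pQ k' : p k' <= f x0 * h ^+ d.
  by rewrite -lee_fin -(pE i0); apply: bin_prob_le => //; exact: ltW.
set u := j%:R `^ beta; set v := h `^ beta.
have v0 : 0 < v by exact: powR_gt0.
have jhE : (j%:R * h) `^ beta = u * v.
  by rewrite powRM ?ler0n ?(ltW h_gt0).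
have jC' : 2 * C0 <= c1 * u by rewrite [c1 * u]mulrC -ler_pdivrMr.
have pk : p k <= (f x0 - c1 * (u * v)) * h ^+ d.
  (* [bin_prob_le] asks for a nonnegative bound; this comes from [f >= 0] at a point of the bin,
     which exists since a bin contains its corner. *)
  have [[x xk]|nx] := pselect (exists x, bin_index h x = k).
    have H y : bin_index h y = k -> f y <= f x0 - c1 * (u * v).
      by move=> yk; rewrite -jhE; apply: far_bin_density => //; rewrite yk.
    rewrite -lee_fin -(pE i0); apply: bin_prob_le => //.
    by apply: le_trans (H _ xk).
  exfalso; apply: nx; exists (bin_corner h k); apply: eq_from_tnth => i.
  apply/eqP; rewrite !tnth_map floor_div_eq// lexx /=.
  by rewrite ltr_pM2r// ltr_int ltrDl.
have pk0 : (f x0 - C0 * v) * h ^+ d <= p k0.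
  rewrite -lee_fin -(pE i0); apply: bin_prob_ge => // x xk0.
  have xh : supdist x x0 <= h by apply: same_bin_supdist.
  apply: le_trans (f_near _ (le_trans xh hh0)).1.
  rewrite lerD2l lerN2 ler_pM2l//.
  by apply: ge0_ler_powR; rewrite ?nnegrE ?supdist_ge0 ?(ltW beta_gt0) ?(ltW h_gt0).
have gap : c1 / 2 * (u * v) * h ^+ d <= p k0 - p k.
  suff : c1 / 2 * (u * v) * h ^+ d <=
      (f x0 - C0 * v) * h ^+ d - (f x0 - c1 * (u * v)) * h ^+ d by lra.
  rewrite -mulrBl ler_pM2r//.
  have : 2 * C0 * v <= c1 * u * v by rewrite ler_pM2r.
  lra.
have kk0 : k != k0.
  apply/eqP => kk; move: j2; rewrite /j kk /index_dist big1// => i _.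
  by rewrite subrr.
have gap_ge0 : 0 <= c1 / 2 * (u * v) * h ^+ d.
  apply: mulr_ge0; last exact: ltW.
  apply: mulr_ge0; last by rewrite mulr_ge0 ?powR_ge0.
  by rewrite divr_ge0 ?(ltW c1_gt0).
have Q_gt0 : 0 < f x0 * h ^+ d by rewrite mulr_gt0.
apply: le_trans (prob_count_ge _ _ _ P _ _ X h (p k) (p k0) _ (f x0 * h ^+ d)
  k k0 h_gt0 (fun i => (Xf i).1) indepX kk0 (pE^~ k) (pE^~ k0) (p_ge0 k) (pQ k)
  gap_ge0 gap _ Q_gt0) _.
  by have := pQ k0; have := p_ge0 k; lra.
rewrite lee_fin ler_expR lerN2 le_eqVlt; apply/orP; left; apply/eqP.
have -> : j%:R `^ (2 * beta) = u ^+ 2.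
  by rewrite mulrC powRrM powR_mulrn ?powR_ge0.
have -> : T = n%:R * (h ^+ d * v ^+ 2).
  rewrite /T powRD; last by rewrite (gt_eqF h_gt0) implybT.
  by rewrite powR_mulrn ?(ltW h_gt0)// [2 * _]mulrC powRrM powR_mulrn ?powR_ge0.
by rewrite /kappa; field; rewrite !gt_eqF.
Qed.

Lemma prob_off_cube (i : 'I_n) :
  P (X i @^-1` off_cube x0 D) = 0%E.
Proof. by apply: (prob_off_support _ _ _ P _ _ f) => //; exact: measurable_off_cube. Qed.

(** Off the null event that a sample point leaves the cube, the output is within [h] of a sample
    point that is itself coordinatewise within [D] of [x0], and [D + h <= (D / h0 + 1) h]. *)
Lemma coarse_bins (A : R) : h0 <= h -> D / h0 + 1 <= A ->
  P (~` [set w | forall y, mode_hunting_outputs h (X^~ w) y ->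
                 supdist y x0 <= A * h]) = 0%E.
Proof.
move=> h0h AD; apply/eqP; rewrite eq_le measure_ge0 andbT.
have -> : 0%E = (\sum_(i < n)
    P (X i @^-1` off_cube x0 D))%E.
  by rewrite big1// => i _; exact: prob_off_cube.
apply: measure_union_bound.
- apply: measurableC; apply: measurable_output_event => // i; exact: (Xf i).1.
- move=> i; rewrite -[X in measurable X]setTI; apply: (Xf i).1 => //.
  exact: measurable_off_cube.
move=> w /= /existsNP[y /not_implyP[[i [_ ->]] /negP]]; rewrite -ltNge => Ay.
rewrite -bigcup_seq; exists i => /=; first by rewrite mem_index_enum.
apply: contrapT => /forallNP nD; move: Ay; apply/negP; rewrite -leNgt.
apply: supdist_le => [|l]; first by rewrite mulr_ge0 ?(ltW h_gt0)//
  (le_trans _ AD)// addr_ge0 ?divr_ge0 ?(ltW D_gt0) ?(ltW h0_gt0).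
have H1 := le_trans (le_supdist _ _ _ _ l) (bin_corner_dist R d h h_gt0 (X i w)).
have H2 : `|tnth (X i w) l - tnth x0 l| <= D.
  by rewrite leNgt; apply/negP; exact: nD.
have H3 : D + h <= A * h.
  apply: (@le_trans _ _ ((D / h0 + 1) * h)); last by rewrite ler_pM2r.
  rewrite mulrDl mul1r lerD2r mulrAC ler_pdivlMr// ler_pM2l//.
by apply: le_trans (ler_distD (tnth (X i w) l) _ _) _; lra.
Qed.

(** On the bad event, a sample point leaves the cube or the winning bin is a shift of [k0] by some
    [j >= J] with [j h <= 2 D], and its count is at least that of [k0]. The union bound is then
    enlarged to all nonzero shifts, a sum that can be bounded uniformly in [N]. *)
Lemma fine_bins (A : R) (J : nat) : (0 < n)%N -> h <= h0 -> (2 <= J)%N ->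
  2 * C0 / c1 <= J%:R `^ beta -> J%:R + 1 <= A ->
  exists N : nat,
  (P (~` [set w | forall y, mode_hunting_outputs h (X^~ w) y ->
                  (supdist y x0 <= A * h)%R]) <=
  (\sum_(g : {ffun 'I_d -> 'I_N.+1 * bool} | (0 < shift_norm g)%N)
    expR (- (kappa * T * (shift_norm g)%:R `^ (2 * beta))))%:E)%E.
Proof.
move=> n_gt0 hh0 J2 JC JA; pose N := Num.truncn (2 * D / h); exists N.
pose Q (g : {ffun 'I_d -> 'I_N.+1 * bool}) :=
  (J <= shift_norm g)%N && ((shift_norm g)%:R * h <= 2 * D).
pose far (s : 'I_n + {ffun 'I_d -> 'I_N.+1 * bool}) :=
  match s with
  | inl i => X i @^-1` off_cube x0 D
  | inr g => [set w | (bin_count h (X^~ w) k0 <=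
                       bin_count h (X^~ w) (shift_bin k0 g))%N]
  end.
pose far_index (s : 'I_n + {ffun 'I_d -> 'I_N.+1 * bool}) :=
  if s is inr g then Q g else true.
have mX i : measurable_fun setT (X i) := (Xf i).1.
apply: (@le_trans _ _ (\sum_(s | far_index s) P (far s))%E).
  apply: measure_union_bound.
  - by apply: measurableC; apply: measurable_output_event.
  - case=> [i|g] /=; last exact: measurable_count_event.
    rewrite -[X in measurable X]setTI; apply: mX => //.
    exact: measurable_off_cube.
  move=> w /= /existsNP[y /not_implyP[[i [imax ->]] /negP]]; rewrite -ltNge => Ay.
  rewrite -bigcup_seq_cond.
  have [nD|nD] := pselect (off_cube x0 D (X i w)).
    by exists (inl i) => //=; rewrite mem_index_enum.
  set k := bin_index h (X i w) in imax Ay.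
  pose j := index_dist k k0.
  have Dr : supdist (X i w) x0 <= D.
    apply: supdist_le => [|l]; first exact: ltW.
    by rewrite leNgt; apply/negP => Dl; apply: nD; exists l.
  have Jj : (J <= j)%N.
    have := lt_le_trans Ay (bin_corner_supdist_le R d h h_gt0 k x0).
    rewrite ltr_pM2r// -/k0 -/j => Aj.
    by rewrite -(ler_nat R); lra.
  (* Here [(j - 1) h <= D], and [j <= 2 (j - 1)] because [j >= J >= 2]. *)
  have jD : j%:R * h <= 2 * D.
    have := le_trans (bin_supdist_ge R d h h_gt0 (X i w) x0) Dr.
    have : 0 <= (j%:R - 2) * h.
      by rewrite mulr_ge0 ?(ltW h_gt0)// subr_ge0 (ler_nat _ 2) (leq_trans J2).
    rewrite -/k0 -/k -/j; lra.
  have jN : (j <= N)%N.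
    rewrite /N truncn_ge_nat; first by rewrite ler_pdivlMr.
    by rewrite divr_ge0 ?mulr_ge0 ?(ltW D_gt0) ?(ltW h_gt0).
  have [g gk] := shift_bin_surj k0 k jN.
  have gj : shift_norm g = j by rewrite -(index_dist_shift k0) gk.
  exists (inr g) => /=; first by rewrite mem_index_enum /Q gj Jj.
  rewrite gk.
  (* Maximality compares only with bins of sample points; if [k0] holds none, its count is [0]. *)
  have [[l lk]|nl] := pselect (exists l, bin_index h (X l w) = k0).
    by rewrite -lk; exact: imax.
  rewrite bin_countE eq_card0// => l; rewrite inE; apply/negP => /eqP lk.
  by apply: nl; exists l.
rewrite big_sumType /= big1 ?add0e => [|i _]; last exact: prob_off_cube.
rewrite -sumEFin; rewrite [leRHS](bigID Q) /=.
apply: (@le_trans _ _ (\sum_(g | (0 < shift_norm g)%N && Q g)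
    (expR (- (kappa * T * (shift_norm g)%:R `^ (2 * beta))))%:E)%E); last first.
  by rewrite leeDl// sume_ge0// => g _; rewrite lee_fin expR_ge0.
have Q0 g : Q g = (0 < shift_norm g)%N && Q g.
  case: (boolP (Q g)) => [/andP[Jg _]|_]; last by rewrite andbF.
  by rewrite andbT (leq_trans _ Jg)// ltnW.
rewrite (eq_bigl _ _ Q0); apply: lee_sum => g /andP[_ /andP[Jg gD]].
have E := index_dist_shift k0 g.
rewrite -[in leRHS]E; apply: far_bin_prob => //; rewrite E//.
  exact: leq_trans Jg.
apply: le_trans JC _.
by apply: ge0_ler_powR; rewrite ?nnegrE ?ler0n ?(ltW beta_gt0)// ler_nat.
Qed.

End sample.

Lemma mode_hunting_bound : exists A : R, 0 < A /\
  forall (n : nat) (h : R), 0 < h ->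
  forall (d0 : measure_display) (Omega : measurableType d0)
         (P : probability Omega R) (X : 'I_n -> Omega -> d.-tuple R),
    (forall i, has_density P (X i) f) -> mutually_independent P X ->
    ((1 - A * expR (- (n%:R * h `^ (d%:R + 2 * beta)) / A))%:E
      <= P [set w | forall y, mode_hunting_outputs h (X^~ w) y ->
                    (supdist y x0 <= A * h)%R])%E.
Proof.
have kappa2_gt0 : 0 < kappa / 2 by rewrite divr_gt0.
have beta2_gt0 : 0 < 2 * beta by rewrite mulr_gt0.
have [C C_gt0 HC] := sum_shift_expR_bounded R (kappa / 2) (2 * beta) d
  kappa2_gt0 beta2_gt0.
(* Truncation plus one already exceeds the real root; the further one ensures [2 <= J]. *)
pose J := (Num.truncn ((2 * C0 / c1) `^ beta^-1)).+2.
have JC : 2 * C0 / c1 <= J%:R `^ beta.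
  have q0 : 0 <= 2 * C0 / c1 by rewrite ltW// divr_gt0// mulr_gt0.
  have -> : 2 * C0 / c1 = ((2 * C0 / c1) `^ beta^-1) `^ beta.
    by rewrite -powRrM mulVf ?gt_eqF// powRr1.
  apply: ge0_ler_powR; rewrite ?nnegrE ?powR_ge0 ?(ltW beta_gt0)//.
  apply: le_trans (ltW (truncnS_gt _)) _.
  by rewrite ler_nat.
have Dh0 : 0 < D / h0 by rewrite divr_gt0.
have k2 : 0 < 2 / kappa by rewrite divr_gt0.
(* The summands serve in turn: [3] gives [A - T >= 1] when [T < 1], and with [J] it gives
   [J + 1 <= A] for [fine_bins]; [D / h0] is for [coarse_bins], [C] for the prefactor, and
   [2 / kappa] for the rate [1 / A <= kappa / 2]. *)
pose A := 3 + J%:R + D / h0 + C + 2 / kappa.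
have J_ge0 : 0 <= J%:R :> R by [].
have A_gt0 : 0 < A by rewrite /A; lra.
exists A; split => // n h h_gt0 d0 Omega P X Xf indepX.
set good := [set w | _]; set T := n%:R * _.
have mgood : measurable good.
  by apply: measurable_output_event => // i; exact: (Xf i).1.
have T_ge0 : 0 <= T by rewrite mulr_ge0 ?powR_ge0.
suff bad : T < 1 \/ (P (~` good) <= (A * expR (- T / A))%:E)%E.
  case: bad => [T1|bad].
    apply: (@le_trans _ _ 0%E); last exact: measure_ge0.
    rewrite lee_fin subr_le0.
    have : A * (1 + - T / A) <= A * expR (- T / A).
      by rewrite ler_pM2l// expR_ge1Dx.
    have -> : A * (1 + - T / A) = A - T by field; rewrite gt_eqF.
    rewrite /A; lra.
  rewrite -[good]setCK probability_setC; last exact: measurableC.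
  by rewrite EFinB leeB.
have [T1|T1] := ltP T 1; [by left|right].
have [h0h|hh0] := leP h0 h.
  rewrite (coarse_bins _ _ _ _ _ _ h_gt0 Xf) //; last by rewrite /A; lra.
  by rewrite lee_fin mulr_ge0 ?expR_ge0 ?(ltW A_gt0).
have n_gt0 : (0 < n)%N.
  by case: (posnP n) T1 => // n0; rewrite /T n0 mul0r ler10.
have [N HN] := fine_bins _ _ P n h X h_gt0 Xf indepX A J n_gt0 (ltW hh0) isT JC
  ltac:(rewrite /A; lra).
apply: le_trans HN _; rewrite -/T lee_fin.
apply: (@le_trans _ _ (C * expR (- (kappa / 2 * T)))); last first.
  apply: ler_pM; rewrite ?(ltW C_gt0) ?expR_ge0//; first by rewrite /A; lra.
  rewrite ler_expR mulNr lerN2 mulrC ler_pM2r ?(lt_le_trans ltr01 T1)//.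
  have -> : kappa / 2 = (2 / kappa)^-1 by rewrite invf_div.
  by rewrite lef_pV2 ?posrE// /A; lra.
apply: le_trans (ler_wpM2r (expR_ge0 _) (HC N)); rewrite mulr_suml.
apply: ler_sum => g g_gt0; rewrite -expRD ler_expR.
set u := _ `^ _; have u1 : 1 <= u.
  rewrite -[leLHS](powRr0 (shift_norm g)%:R); apply: ler_powR; last exact: ltW.
  by rewrite ler1n.
(* With [T] and [u] at least [1], half of the exponent yields the factor in [T] and the other half
   the summable term in [u]. *)
have : T + u <= 2 * (T * u) by nra.
have := kappa_gt0; nra.
Qed.

End mode.

(** * Positivity of the maximum and a cube containing the support *)

Theorem theorem1 (R : realType) (d : nat) (f : d.-tuple R -> R)
  (x0 : d.-tuple R) (c0 C0 h0 beta : R) :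
  (1 <= d)%N ->
  probability_density f ->
  (exists M : R, forall x, M < supdist x (nseq_tuple d 0) -> f x = 0) ->
  (forall x, x != x0 -> f x < f x0) ->
  0 < c0 -> c0 < C0 -> 0 < h0 -> 0 < beta ->
  (forall x, supdist x x0 <= h0 ->
     f x0 - C0 * supdist x x0 `^ beta <= f x /\
     f x <= f x0 - c0 * supdist x x0 `^ beta) ->
  (forall x, h0 <= supdist x x0 -> f x <= f x0 - c0 * h0 `^ beta) ->
  exists A : R, 0 < A /\
    forall (n : nat) (h : R), 0 < h ->
    forall (d0 : measure_display) (Omega : measurableType d0)
           (P : probability Omega R) (X : 'I_n -> Omega -> d.-tuple R),
      (forall i, has_density P (X i) f) ->
      mutually_independent P X ->
      ((1 - A * expR (- (n%:R * h `^ (d%:R + 2 * beta)) / A))%:E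
        <= P [set w | forall y,
                mode_hunting_outputs h (fun i => X i w) y ->
                (supdist y x0 <= A * h)%R])%E.
Proof.
move=> d_gt0 [_ [f_ge0 _]] [M fM] f_max c0_gt0 c0C0 h0_gt0 beta_gt0 f_near f_far.
have C0_gt0 : 0 < C0 by exact: lt_trans c0C0.
have f_le x : f x <= f x0.
  by have [->//|/f_max/ltW] := eqVneq x x0.
have fx0_gt0 : 0 < f x0.
  (* Since [d >= 1], this point differs from [x0], and strict maximality against it forces
     [f x0 > 0]. *)
  pose x1 : d.-tuple R := [tuple tnth x0 i + 1 | i < d].
  apply: le_lt_trans (f_ge0 x1) (f_max _ _); apply/eqP => x10.
  have := congr1 (fun x => tnth x (Ordinal d_gt0)) x10.
  by rewrite tnth_mktuple => e; lra.
pose z : d.-tuple R := nseq_tuple d 0.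
(* A coordinate farther than [D] from that of [x0] exceeds [M] in absolute value; [M] enters through
   its absolute value so that [h0 <= D] even if [M < 0]. *)
pose D := h0 + `|M| + supdist x0 z.
have h0D : h0 <= D by rewrite /D -addrA lerDl addr_ge0// supdist_ge0.
apply: (mode_hunting_bound R d f x0 c0 C0 h0 beta D) => //.
move=> x [i Di]; apply: fM; apply: lt_le_trans (le_supdist _ _ x z i).
have := le_supdist _ _ x0 z i; have := ler_norm M.
have := ler_normB (tnth x i) (tnth x0 i).
have -> : tnth z i = 0 by rewrite tnth_nseq.
rewrite !subr0; move: Di; rewrite /D; lra.
Qed.
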